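(* Let $\mathfrak{C}$ be a monster Banach structure, let $M \preceq \mathfrak{C}$ be a model, and let $p \in S(M)$ be a generically stable wide type. Let $I = (a_i)_{i<\omega}$ be a generic wide indiscernible sequence in $p$. Then $I$ is isometric to the standard basis of $\ell_p$ for some $1 \le p < \infty$, or to the standard basis of $c_0$; that is, either there is $1\le p<\infty$ such that for every $k<\omega$ and all $r_0,\ldots,r_{k-1}\in\mathbb{R}$ \[ \Big\|\sum_{i=0}^{k-1} r_i a_i\Big\| = \Big(\sum_{i=0}^{k-1}|r_i|^p\Big)^{1/p}, \] or for every $k<\omega$ and all $r_0,\ldots,r_{k-1}\in\mathbb{R}$ \[ \Big\|\sum_{i=0}^{k-1} r_i a_i\Big\| = \max\{|r_i| : i<k\}. \]
   Context: $\mathfrak{C}$ is a monster model of a continuous first-order theory expanding a theory of (real or complex) normed spaces, so $\mathfrak{C}$ is a Banach space with uniformly continuous extra structure (a Banach structure); models are complete elementary substructures of $\mathfrak{C}$, and $S(M)$ is the space of types over $M$. For a subspace $B$ of $\mathfrak{C}$, $\mathcal{S}(B)$ denotes the set of elements of $B$ of norm $1$. A type $p\in S(M)$ is wide if there is an infinite-dimensional subspace $B$ of $\mathfrak{C}$ with $\mathcal{S}(B)\subseteq p^{\mathfrak{C}}$ (every norm-one element of $B$ realizes $p$). An indiscernible sequence $I=(a_i)_{i<\omega}$ in $p$ is wide if $I \subseteq \mathcal{S}(B) \subseteq p^{\mathfrak{C}}$ for some infinite-dimensional subspace $B$ of $\mathfrak{C}$; it is generic wide if in addition, for every $n<\omega$,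 $\mathrm{tp}(a_n/M a_{<n})$ is finitely satisfiable in $M$ (i.e. $I$ is a coheir sequence over $M$). For generically stable $p$ this is equivalent to $I$ being a wide Morley sequence over $M$ (each $\mathrm{tp}(a_n/Ma_{<n})$ does not fork over $M$). *)

(* Defs.v *)
From HB Require Import structures.
From mathcomp Require Import all_boot all_order all_algebra.
From mathcomp Require Import all_classical all_reals all_analysis.
From mathcomp Require Import complex.

Set Implicit Arguments.
Unset Strict Implicit.
Unset Printing Implicit Defensive.

Import Order.TTheory GRing.Theory Num.Theory.
Import numFieldNormedType.Exports.

Local Open Scope classical_set_scope.
Local Open Scope ring_scope.

Variant scalar_kind := RealScalars | ComplexScalars.

Definition scalar (R : realType) (k : scalar_kind) : numFieldType :=
  match k with
  | RealScalars => R
  | ComplexScalars => R[i]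
  end.

Definition of_real (R : realType) (k : scalar_kind) : R -> scalar R k :=
  match k return R -> scalar R k with
  | RealScalars => fun r => r
  | ComplexScalars => fun r => r%:C%C
  end.

(* In MathComp-Analysis the norm of a normed space over R[i] takes its values
   in R[i]; [re] brings these (real) values back to R. *)
Definition re (R : realType) (k : scalar_kind) : scalar R k -> R :=
  match k return scalar R k -> R with
  | RealScalars => fun r => r
  | ComplexScalars => fun z => complex.Re z
  end.

Definition nrm (R : realType) (k : scalar_kind)
  (E : normedModType (scalar R k)) (x : E) : R := re `|x|.

(* The non-logical symbols other than those of normed spaces.  Function symbols
   of arity 0 are constant symbols. *)
Record language := Language {
  fsym : Type;
  farity : fsym -> nat;
  psym : Type;
  parity : psym -> nat }.

Definition unif_cont_on_balls (R : realType) (k : scalar_kind)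
    (E : normedModType (scalar R k)) (n : nat) (T : Type)
    (dist : T -> T -> R) (F : ('I_n -> E) -> T) : Prop :=
  forall (N : nat) (e : R), 0 < e -> exists2 d : R, 0 < d &
    forall x y : 'I_n -> E,
      (forall i, nrm (x i) <= N%:R) -> (forall i, nrm (y i) <= N%:R) ->
      (forall i, nrm (x i - y i) < d) -> dist (F x) (F y) <= e.

(* Symbols are interpreted by maps that are uniformly continuous (hence also
   bounded) on bounded sets, i.e. on each of the balls used as sorts in the
   many-sorted presentation of normed structures. *)
Record banach_structure (L : language) (R : realType) (k : scalar_kind) :=
  BanachStructure {
    space :> completeNormedModType (scalar R k);
    fint : forall f : fsym L, ('I_(farity f) -> space) -> space;
    pint : forall P : psym L, ('I_(parity P) -> space) -> R;
    fint_unif : forall f : fsym L,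
      unif_cont_on_balls (fun x y : space => nrm (x - y)) (@fint f);
    pint_unif : forall P : psym L,
      unif_cont_on_balls (fun x y : R => `|x - y|) (@pint P) }.

(* Terms and formulas with free variables in [V]. *)
Inductive term (L : language) (K V : Type) : Type :=
| TVar of V
| TZero
| TAdd of term L K V & term L K V
| TScale of K & term L K V
| TApp (f : fsym L) of ('I_(farity f) -> term L K V).

(* Connectives are arbitrary continuous functions R^n -> R.  [FSup N phi] is
   the supremum of [phi] over the closed ball of radius N, the bound variable
   being [None]; the infimum is - sup (- _). *)
Inductive formula (L : language) (R : realType) (K V : Type) : Type :=
| FNorm of term L K V
| FPred (P : psym L) of ('I_(parity P) -> term L K V)
| FConn (n : nat) (u : 'rV[R]_n -> R) of continuous u &
    ('I_n -> formula L R K V)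
| FSup (N : nat) of formula L R K (option V).

Section Semantics.
Context {L : language} {R : realType} {k : scalar_kind}.
Variable C : banach_structure L R k.

Fixpoint teval (V : Type) (e : V -> C) (t : term L (scalar R k) V) : C :=
  match t with
  | TVar v => e v
  | TZero => 0
  | TAdd t1 t2 => teval e t1 + teval e t2
  | TScale c t1 => c *: teval e t1
  | TApp f ts => fint (fun i => teval e (ts i))
  end.

(* Value with quantifiers ranging over [D]: [D = setT] gives the value in the
   structure, and for a substructure M, [D = M] gives the value in M. *)
Fixpoint feval (D : set C) (V : Type) (e : V -> C)
    (phi : formula L R (scalar R k) V) : R :=
  match phi with
  | FNorm t => nrm (teval e t)
  | FPred P ts => pint (fun i => teval e (ts i))
  | FConn n u _ phis => u (\row_i feval D e (phis i))
  | FSup N psi =>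
      sup [set feval D (fun o => oapp e x o) psi
          | x in [set x | D x /\ nrm x <= N%:R]]
  end.

Definition elementary_substructure (M : set C) : Prop :=
  [/\ closed M,
      M 0 /\ (forall (c : scalar R k) x y, M x -> M y -> M (c *: x + y)),
      (forall (f : fsym L) x, (forall i, M (x i)) -> M (fint (f := f) x)) &
      (forall (n : nat) (phi : formula L R (scalar R k) 'I_n) (e : 'I_n -> C),
         (forall i, M (e i)) -> feval M e phi = feval setT e phi)].

Record pformula (V : Type) := PFormula {
  nparams : nat;
  body : formula L R (scalar R k) (V + 'I_nparams)%type;
  params : 'I_nparams -> C }.

Arguments params {V} p _ : rename.

Definition over (V : Type) (A : set C) (phi : pformula V) : Prop :=
  forall i, A (params phi i).

Definition value (V : Type) (phi : pformula V) (x : V -> C) : R :=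
  feval setT
    (fun v => match v with inl w => x w | inr i => params phi i end)
    (body phi).

Definition value1 (phi : pformula unit) (x : C) : R :=
  value phi (fun=> x).

Definition map_params (V : Type) (s : C -> C) (phi : pformula V) :
    pformula V :=
  PFormula (body phi) (s \o params phi).

(* A complete 1-type assigns to each formula the value it prescribes; only the
   values at formulas over the relevant parameter set are meaningful. *)
Definition pretype := pformula unit -> R.

(* p is a complete type over A, i.e. approximately finitely satisfiable in C;
   the ball is fixed since the structure is unbounded. *)
Definition is_type (A : set C) (p : pretype) : Prop :=
  exists N : nat, forall F : set (pformula unit),
    finite_set F -> F `<=` over A -> forall e : R, 0 < e ->
    exists x : C, nrm x <= N%:R /\
      forall phi, F phi -> `|value1 phi x - p phi| < e.

Definition realizes (A : set C) (p : pretype) (a : C) : Prop :=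
  forall phi, over A phi -> value1 phi a = p phi.

Definition realizations (A : set C) (p : pretype) : set C :=
  [set a | realizes A p a].

Definition automorphism (s : C -> C) : Prop :=
  [/\ bijective s,
      (forall (c : scalar R k) x y, s (c *: x + y) = c *: s x + s y),
      (forall x, nrm (s x) = nrm x),
      (forall (f : fsym L) x, s (fint (f := f) x) = fint (f := f) (s \o x)) &
      (forall (P : psym L) x, pint (P := P) (s \o x) = pint (P := P) x)].

Definition elementary_map (A : set C) (f : C -> C) : Prop :=
  forall (n : nat) (phi : formula L R (scalar R k) 'I_n) (e : 'I_n -> C),
    (forall i, A (e i)) -> feval setT (f \o e) phi = feval setT e phi.

(* The cardinal of X is strictly below that of kappa (cardinals being
   comparable). *)
Definition smaller (kappa T : Type) (X : set T) : Prop :=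
  ~ ([set: kappa] #<= X)%card.

(* The condition [phi = 0] is represented by [phi]. *)
Definition saturated (kappa : Type) : Prop :=
  forall (A : set C) (n : nat) (G : set (pformula 'I_n)) (N : nat),
    smaller kappa A -> G `<=` over A ->
    (forall F : set (pformula 'I_n), finite_set F -> F `<=` G ->
       exists x : 'I_n -> C, (forall i, nrm (x i) <= N%:R) /\
         forall phi, F phi -> value phi x = 0) ->
    exists x : 'I_n -> C, (forall i, nrm (x i) <= N%:R) /\
      forall phi, G phi -> value phi x = 0.

Definition strongly_homogeneous (kappa : Type) : Prop :=
  forall (A : set C) (f : C -> C), smaller kappa A -> elementary_map A f ->
    exists s : C -> C, automorphism s /\ forall x, A x -> s x = f x.

Definition monster (kappa : Type) : Prop :=
  [/\ ~ countable [set: kappa],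
      smaller kappa [set: fsym L] /\ smaller kappa [set: psym L],
      saturated kappa & strongly_homogeneous kappa].

Definition invariant (M : set C) (p : pretype) : Prop :=
  forall s, automorphism s -> (forall x, M x -> s x = x) ->
  forall phi, p (map_params s phi) = p phi.

Definition well_order (I : Type) (lt : I -> I -> Prop) : Prop :=
  [/\ well_founded lt,
      (forall i j l, lt i j -> lt j l -> lt i l) &
      (forall i j, [\/ lt i j, i = j | lt j i])].

(* A Morley sequence over M in the global M-invariant type p, of length the
   order type of (I, lt). *)
Definition morley_sequence (M : set C) (p : pretype)
    (I : Type) (lt : I -> I -> Prop) (a : I -> C) : Prop :=
  forall i, realizes (M `|` [set a j | j in [set j | lt j i]]) p (a i).

(* Generic stability after Pillay and Tanovic: p has a global M-invariant
   extension such that, along Morley sequences of any ordinal length, every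
   formula over C is eventually constant "up to finitely many indices".  In
   continuous logic, "finite or cofinite truth set" becomes convergence along
   the filter of cofinite sets. *)
Definition generically_stable (M : set C) (p : pretype) : Prop :=
  exists q : pretype,
    [/\ is_type setT q,
        (forall phi, over M phi -> q phi = p phi),
        invariant M q &
        forall (I : Type) (lt : I -> I -> Prop) (a : I -> C),
          well_order lt -> morley_sequence M q lt a ->
          forall phi : pformula unit, exists v : R, forall e : R, 0 < e ->
            finite_set [set i | e <= `|value1 phi (a i) - v|] ].

Definition subspace (B : set C) : Prop :=
  B 0 /\ forall (c : scalar R k) x y, B x -> B y -> B (c *: x + y).

Definition infinite_dimensional (B : set C) : Prop :=
  ~ exists (n : nat) (b : 'I_n -> C), forall x, B x ->
      exists c : 'I_n -> scalar R k, x = \sum_(i < n) c i *: b i.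

Definition sphere (B : set C) : set C := [set x | B x /\ nrm x = 1].

Definition wide (M : set C) (p : pretype) : Prop :=
  exists B : set C, [/\ subspace B, infinite_dimensional B &
    sphere B `<=` realizations M p].

(* Indiscernibility over the empty set, which is all that is required. *)
Definition indiscernible (a : nat -> C) : Prop :=
  forall (n : nat) (s t : 'I_n -> nat),
    {homo s : i j / (i < j)%N} -> {homo t : i j / (i < j)%N} ->
    forall phi : formula L R (scalar R k) 'I_n,
      feval setT (a \o s) phi = feval setT (a \o t) phi.

Definition wide_sequence (M : set C) (p : pretype) (a : nat -> C) : Prop :=
  [/\ indiscernible a, (forall i, realizes M p (a i)) &
    exists B : set C, [/\ subspace B, infinite_dimensional B,
      (forall i, sphere B (a i)) & sphere B `<=` realizations M p]].

(* tp(a/A) is finitely satisfiable in M.  Formulas can be taken one at a time,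
   since finitely many conditions are combined by a connective. *)
Definition finitely_satisfiable (M A : set C) (a : C) : Prop :=
  forall phi : pformula unit, over A phi -> forall e : R, 0 < e ->
    exists2 m, M m & `|value1 phi m - value1 phi a| < e.

Definition generic_wide_sequence (M : set C) (p : pretype) (a : nat -> C) :
    Prop :=
  wide_sequence M p a /\
  forall n, finitely_satisfiable M
    (M `|` [set a i | i in [set i | (i < n)%N]]) (a n).

End Semantics.

(* Main.v *)
(* Normalized combinations x/|x| of the a_i realize p, just as a_0 does.  As
   tp(a_n/M a_<n) is a coheir, |x + r a_n| depends on x in the span of a_<n only
   through |x|, so all norms are obtained by iterating F(s,t) = |s a_0 + t a_1|.
   Generic stability makes the norm |r a + s b| the same for all a, b in p such
   that tp(b/M a) is a coheir of p; taking for b the normalized s a_1 + t a_2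
   shows that F is associative.  By Bohnenblust's argument F(s,t) is then
   (s^q + t^q)^(1/q) or max(s,t) for s, t >= 0. *)

Require Import Defs.
From mathcomp Require Import all_boot all_order all_algebra.
From mathcomp Require Import all_classical all_reals all_analysis.
From mathcomp Require Import complex ring lra.

Set Implicit Arguments.
Unset Strict Implicit.
Unset Printing Implicit Defensive.

Import Order.TTheory GRing.Theory Num.Theory.
Import numFieldNormedType.Exports.
Import Defs.
Local Open Scope classical_set_scope.
Local Open Scope ring_scope.

(** The two arguments of [F] are not on the same footing. A combination x of earlier terms may be
    exchanged on the left because a coheir is tested only at points m of [M], and |x + r m| is
    decided by the type of x over [M]. Exchanging the later element on the right compares two
    coheirs of [p] over [M a_0], about which the types over [M] alone say nothing; this is where
    generic stability enters, through a Morley sequence of length omega + omega. Its first half has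
    a prescribed norm against some [d], its second half is generic over [d], and the limit of a
    formula along the sequence cannot tell the halves apart. Both coheirs thus get the norm
    prescribed by a global invariant extension [q] of [p]. The left exchange also removes signs, and
    with convexity this yields the monotonicity that replaces continuity in Bohnenblust's argument.
    The exponent is read off from F(1, 1) = 2^(1/q): the triangle inequality F(1, 1) <= 2 gives q >=
    1, and F(1, 1) = 1 would mean q infinite, which is why c_0 splits off. *)

Section Norm.
Context {R : realType} {K : scalar_kind} {E : normedModType (scalar R K)}.
Implicit Types (x y : E) (r : R).

Lemma nrm_ge0 x : 0 <= nrm x.
Proof.
have := normr_ge0 x; rewrite /nrm; case: K E x => //= F x.
by rewrite lecE => /andP[].
Qed.

Lemma nrmD x y : nrm (x + y) <= nrm x + nrm y.
Proof.
have := ler_normD x y; rewrite /nrm; case: K E x y => //= F x y.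
by rewrite lecE => /andP[_]; case: (`|x|) (`|y|) => ? ? [].
Qed.

Lemma nrm_eq0 x : nrm x = 0 -> x = 0.
Proof.
rewrite /nrm; case: K E x => /= F x.
  by move=> /eqP; rewrite normr_eq0 => /eqP.
have := normr_ge0 x; rewrite lecE => /andP[/eqP + _] re0.
move=> im0; apply/eqP; rewrite -normr_eq0; apply/eqP.
by case: (`|x|) re0 im0 => u v /= -> ->.
Qed.

Lemma nrm0 : nrm (0 : E) = 0.
Proof. by rewrite /nrm; case: K E => F; rewrite normr0. Qed.

Lemma nrmZ r x : nrm (of_real K r *: x) = `|r| * nrm x.
Proof.
rewrite /nrm; case: K E x => F x /=; rewrite normrZ //.
rewrite normc_def /= expr0n addr0 sqrtr_sqr.
by case: (`|x|) => u v /=; rewrite mul0r subr0.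
Qed.

Lemma nrmN x : nrm (- x) = nrm x.
Proof. by rewrite /nrm normrN. Qed.

End Norm.

Section OfReal.
Context {R : realType} (K : scalar_kind).
Implicit Types r s : R.

Lemma of_realD r s : of_real K (r + s) = of_real K r + of_real K s.
Proof. by case: K => //=; rewrite rmorphD. Qed.

Lemma of_realM r s : of_real K (r * s) = of_real K r * of_real K s.
Proof. by case: K => //=; rewrite rmorphM. Qed.

Lemma of_realN r : of_real K (- r) = - of_real K r.
Proof. by case: K => //=; rewrite rmorphN. Qed.

Lemma of_real0 : of_real K 0 = 0 :> scalar R K.
Proof. by case: K. Qed.

Lemma of_real1 : of_real K 1 = 1 :> scalar R K.
Proof. by case: K. Qed.

End OfReal.

(** * Substitution of terms in formulas *)

Section Substitution.
Context {L : language} {R : realType} {K : scalar_kind}.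
Notation term := (term L (scalar R K)).
Notation formula := (formula L R (scalar R K)).

Fixpoint tsubst (V W : Type) (s : V -> term W) (t : term V) : term W :=
  match t with
  | TVar v => s v
  | TZero => TZero L _ W
  | TAdd t1 t2 => TAdd (tsubst s t1) (tsubst s t2)
  | TScale c t1 => TScale c (tsubst s t1)
  | TApp f ts => TApp (fun i => tsubst s (ts i))
  end.

Definition tlift (V W : Type) (s : V -> term W) (o : option V) :
    term (option W) :=
  if o is Some v then tsubst (fun w => TVar L _ (Some w)) (s v)
  else TVar L _ None.

Fixpoint fsubst (V : Type) (phi : formula V) (W : Type) (s : V -> term W) :
    formula W :=
  match phi with
  | FNorm t => FNorm R (tsubst s t)
  | FPred P ts => FPred R (fun i => tsubst s (ts i))
  | FConn n u cu phis => FConn cu (fun i => fsubst (phis i) s)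
  | FSup N psi => FSup N (fsubst psi (tlift s))
  end.

Context {C : banach_structure L R K}.

Lemma teval_tsubst (V W : Type) (e : W -> C) (s : V -> term W) t :
  teval e (tsubst s t) = teval (fun v => teval e (s v)) t.
Proof.
elim: t => //= [t1 -> t2 ->|c t ->|f ts IH] //.
by congr fint; apply/funext => i.
Qed.

Lemma feval_fsubst (D : set C) (V W : Type) (e : W -> C) (s : V -> term W)
    (phi : formula V) :
  feval D e (fsubst phi s) = feval D (fun v => teval e (s v)) phi.
Proof.
elim: phi W e s => {V} /= [V t|V P ts|V n u cu phis IH|V N psi IH] W e s.
- by rewrite teval_tsubst.
- by congr pint; apply/funext => i; rewrite teval_tsubst.
- by congr u; apply/rowP => i; rewrite !mxE IH.
- congr sup; apply: eq_imagel => x _; rewrite IH; congr feval.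
  by apply/funext => -[v|] //=; rewrite teval_tsubst.
Qed.

Lemma teval_sum (V I : Type) (e : V -> C) (r : seq I) (t : I -> term V) :
  teval e (\big[@TAdd L _ V/TZero L _ V]_(i <- r) t i) =
    \sum_(i <- r) teval e (t i).
Proof. exact: (big_morph (teval e)). Qed.

End Substitution.

(** Archimedean property; it turns estimates with an error of order 1/n into equalities. *)
Lemma le_natr_bounded (R : realType) (x y : R) :
  (forall n : nat, n%:R * x <= y) -> x <= 0.
Proof.
move=> xy; rewrite leNgt; apply/negP => x0.
have := xy (Num.trunc (y / x)).+1; rewrite -ler_pdivlMr // leNgt.
have [y0|y0] := leP 0 (y / x); first by have /andP[_ ->] := truncn_itv y0.
by rewrite (lt_trans y0).
Qed.

(* Bohnenblust's functional equation.  By associativity and homogeneity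
   [iterF n = F (... (F 1 1) ...) 1] is multiplicative in [n]. *)
Section FunctionalEquation.
Context {R : realType} {F : R -> R -> R}.
Hypothesis FZ : forall c s t : R, 0 <= c -> F (c * s) (c * t) = c * F s t.
Hypothesis Fs0 : forall s : R, 0 <= s -> F s 0 = s.
Hypothesis F0t : forall t : R, 0 <= t -> F 0 t = t.
Hypothesis Fmonor : forall s t u : R, 0 <= s -> 0 <= t -> t <= u -> F s t <= F s u.
Hypothesis Fmonol : forall s t u : R, 0 <= t -> 0 <= s -> s <= u -> F s t <= F u t.
Hypothesis FA : forall r s t : R, 0 <= r -> 0 <= s -> 0 <= t ->
  F (F r s) t = F r (F s t).
Hypothesis F11 : F 1 1 <= 2.

Let iterF (n : nat) : R := iter n (F^~ 1) 0.

Lemma binorm_ge (s t : R) : 0 <= s -> 0 <= t -> s <= F s t.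
Proof. by move=> s0 t0; rewrite -[leLHS]Fs0 // Fmonor. Qed.

Lemma binorm_ge0 (s t : R) : 0 <= s -> 0 <= t -> 0 <= F s t.
Proof. by move=> s0 t0; rewrite (le_trans s0)// binorm_ge. Qed.

Lemma iterF_ge0 n : 0 <= iterF n.
Proof. by elim: n => //= n IH; rewrite binorm_ge0. Qed.

Lemma iterF1 : iterF 1 = 1. Proof. by rewrite /iterF /= F0t. Qed.

Lemma iterF_le m n : (m <= n)%N -> iterF m <= iterF n.
Proof.
move=> /subnK <-; elim: (n - m)%N => //= k IH; apply: (le_trans IH).
by rewrite binorm_ge ?iterF_ge0.
Qed.

Lemma iterF_gt0 n : (0 < n)%N -> 0 < iterF n.
Proof. by move=> n0; rewrite (lt_le_trans _ (iterF_le n0))// iterF1. Qed.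

Lemma iterFD m n : iterF (m + n) = F (iterF m) (iterF n).
Proof.
elim: n => [|n IH]; first by rewrite addn0 /iterF /= Fs0 ?iterF_ge0.
by rewrite addnS /iterF /= -!/(iterF _) IH FA ?iterF_ge0.
Qed.

Lemma iterFM m n : iterF (m * n) = iterF m * iterF n.
Proof.
elim: m => [|m IH]; first by rewrite mul0n mul0r.
rewrite mulSnr iterFD IH mulrC -{2}[iterF n]mulr1 FZ ?iterF_ge0 //.
by rewrite [iterF n * _]mulrC.
Qed.

Lemma iterFX m n : iterF (m ^ n) = iterF m ^+ n.
Proof. by elim: n => [|n IH]; rewrite ?iterF1 // expnS exprS iterFM IH. Qed.

(** Homogeneity gives [F u u = u]; with u the larger argument, monotonicity squeezes [F s t] between
    u and [F u u]. *)
Lemma binorm_max : F 1 1 = 1 -> forall s t : R, 0 <= s -> 0 <= t -> F s t = Num.max s t.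
Proof.
move=> F1 s t s0 t0; have Fss u : 0 <= u -> F u u = u.
  by move=> u0; rewrite -[u in F u _]mulr1 -[u in F _ u]mulr1 FZ // F1 mulr1.
have [st|st] := leP s t; apply/eqP; rewrite eq_le; apply/andP; split.
- by rewrite -[leRHS]Fss // Fmonol.
- by rewrite -[leLHS]F0t // Fmonol.
- by rewrite -[leRHS]Fss // Fmonor // ltW.
- exact: binorm_ge.
Qed.

Lemma ln2_gt0 : 0 < ln (2 : R).
Proof. by rewrite ln_gt0 // ltr1n. Qed.

(** The l_q norm of a sum of n basis vectors is n^(1/q), so [c], read off at n = 2, is the future
    1/q. *)
Let c : R := ln (iterF 2) / ln 2.

(** A monotone multiplicative sequence is a power of n: comparing n^k with the neighbouring powers
    of 2 leaves an error independent of k. *)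
Lemma ln_iterF n : (0 < n)%N -> ln (iterF n) = c * ln n%:R.
Proof.
move=> n0.
have f21 : 1 <= iterF 2 by rewrite -iterF1 iterF_le.
have lf2 : 0 <= ln (iterF 2) by rewrite ln_ge0.
have cE : c * ln 2 = ln (iterF 2) by rewrite /c divfK // gt_eqF ?ln2_gt0.
have c0 : 0 <= c by rewrite divr_ge0 // ltW ?ln2_gt0.
(* For 2^j <= n^k < 2^(j+1), both k ln (iterF n) and k c ln n lie between j ln (iterF 2) and (j+1)
   ln (iterF 2). *)
have H k : `|k%:R * (ln (iterF n) - c * ln n%:R)| <= ln (iterF 2).
  have nk : (0 < n ^ k)%N by rewrite expn_gt0 n0.
  have /andP[j1 j2] := trunc_log_bounds (isT : 1 < 2)%N nk.
  set j := trunc_log 2 (n ^ k) in j1 j2.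
  have A x y : (0 < x)%N -> (x <= y)%N -> ln (iterF x) <= ln (iterF y).
    by move=> x0 xy; rewrite ler_ln ?posrE ?iterF_gt0 ?iterF_le // (leq_trans x0).
  have B x y : (0 < x)%N -> (x <= y)%N -> c * ln (x%:R : R) <= c * ln y%:R.
    move=> x0 xy; rewrite ler_wpM2l // ler_ln ?posrE ?ltr0n ?ler_nat //.
    by rewrite (leq_trans x0).
  have := A _ _ nk (ltnW j2); have := A (2 ^ j)%N _ (expn_gt0 2 j) j1.
  have := B _ _ nk (ltnW j2); have := B (2 ^ j)%N _ (expn_gt0 2 j) j1.
  rewrite !iterFX !natrX !lnXn ?iterF_gt0 ?ltr0n // !mulrnAr cE.
  rewrite mulr_natl mulrnBl !mulrS ler_norml.
  set u := ln (iterF n) *+ _; set v := _ *+ k; set w := _ *+ j => *.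
  by apply/andP; split; lra.
apply/eqP; rewrite -subr_eq0 -normr_eq0 eq_le normr_ge0 andbT.
apply: (@le_natr_bounded _ _ (ln (iterF 2))) => k.
by have := H k; rewrite normrM normr_nat.
Qed.

Lemma binorm_powR : F 1 1 != 1 -> exists2 q : R, 1 <= q &
  forall s t : R, 0 <= s -> 0 <= t -> F s t = (s `^ q + t `^ q) `^ q^-1.
Proof.
move=> F1.
have f2 : iterF 2 = F 1 1 by rewrite /iterF /= F0t.
have f21 : 1 < iterF 2 by rewrite lt_neqAle f2 eq_sym F1 binorm_ge.
have lf2 : 0 < ln (iterF 2) by rewrite ln_gt0.
have c0 : 0 < c by rewrite divr_gt0 // ln2_gt0.
have c1 : c <= 1.
  rewrite ler_pdivrMr ?ln2_gt0 // mul1r ler_ln ?posrE ?f2 // ?ltr0n //.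
  by rewrite -f2 iterF_gt0.
have fE n : iterF n = n%:R `^ c.
  case: n => [|n]; first by rewrite powR0 ?gt_eqF.
  apply: ln_inj; rewrite ?posrE ?powR_gt0 ?iterF_gt0 ?ltr0n //.
  by rewrite ln_powR ln_iterF.
have cV : c != 0 by rewrite gt_eqF.
exists c^-1; first by rewrite invf_ge1.
rewrite invrK.
have K1 (x : R) : 0 <= x -> (x `^ c) `^ c^-1 = x.
  by move=> x0; rewrite -powRrM divff // powRr1.
have K2 (x : R) : 0 <= x -> (x `^ c^-1) `^ c = x.
  by move=> x0; rewrite -powRrM mulVf // powRr1.
have mono (a b : R) : 0 <= a -> a <= b -> a `^ c <= b `^ c.
  by move=> a0 ab; rewrite ge0_ler_powR ?nnegrE ?(ltW c0) // (le_trans a0).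
have monoV (a b : R) : 0 <= a -> a <= b -> a `^ c^-1 <= b `^ c^-1.
  by move=> a0 ab; rewrite ge0_ler_powR ?nnegrE ?invr_ge0 ?(ltW c0) // (le_trans a0).
(* After scaling by (m+1)^c both arguments are values of [iterF], and [iterFD] adds the indices. *)
have rat m n : F 1 ((n%:R / m.+1%:R) `^ c) = (1 + n%:R / m.+1%:R) `^ c.
  have m0 : 0 < (m.+1%:R : R) by rewrite ltr0n.
  apply: (mulfI (_ : m.+1%:R `^ c != 0)); first by rewrite gt_eqF // powR_gt0.
  rewrite -FZ ?powR_ge0 // mulr1 -!powRM ?addr_ge0 ?divr_ge0 ?ler0n //.
  rewrite mulrDr mulr1 mulrCA divff ?gt_eqF // mulr1 -natrD -!fE.
  by rewrite iterFD.
have F1E (x : R) : 0 <= x -> F 1 (x `^ c) `^ c^-1 = 1 + x.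
  move=> x0; apply/eqP; rewrite -subr_eq0 -normr_eq0 eq_le normr_ge0 andbT.
  apply: (@le_natr_bounded _ _ 1) => -[|m]; first by rewrite mul0r.
  have m0 : 0 < (m.+1%:R : R) by rewrite ltr0n.
  (* x lies between n/(m+1) and (n+1)/(m+1), where [rat] applies; by monotonicity the two sides
     differ by at most 1/(m+1). *)
  have /andP[] := truncn_itv (mulr_ge0 x0 (ltW m0)).
  set n := Num.trunc _; rewrite -ler_pdivrMr // -ltr_pdivlMr // => n1 n2.
  have n0 : 0 <= (n%:R / m.+1%:R : R) by rewrite divr_ge0 ?ler0n.
  have n0' : 0 <= (n.+1%:R / m.+1%:R : R) by rewrite divr_ge0 ?ler0n.
  have L : 1 + n%:R / m.+1%:R <= F 1 (x `^ c) `^ c^-1.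
    rewrite -[leLHS]K1 ?addr_ge0 // -rat monoV ?binorm_ge0 ?powR_ge0 //.
    by rewrite Fmonor ?powR_ge0 ?mono.
  have U : F 1 (x `^ c) `^ c^-1 <= 1 + n.+1%:R / m.+1%:R.
    rewrite -[leRHS]K1 ?addr_ge0 // -rat monoV ?binorm_ge0 ?powR_ge0 //.
    by rewrite Fmonor ?powR_ge0 ?mono // ltW.
  have E : n.+1%:R / m.+1%:R = n%:R / m.+1%:R + m.+1%:R^-1 :> R.
    by rewrite -natr1 mulrDl mul1r.
  rewrite E in n2 U.
  rewrite mulrC -ler_pdivlMr // mul1r ler_norml; apply/andP.
  move: n1 n2 L U; move: (F 1 _ `^ _) (m.+1%:R^-1 : R) (n%:R / m.+1%:R : R) => A D B *.
  split; lra.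
move=> s t s0 t0; have [->|sn0] := eqVneq s 0.
  by rewrite powR0 ?invr_eq0 // add0r F0t // K2.
have {}s0 : 0 < s by rewrite lt_neqAle eq_sym sn0.
have ts0 : 0 <= t / s by rewrite divr_ge0 // ltW.
have -> : F s t = s * F 1 (t / s).
  by rewrite -FZ ?(ltW s0) // mulr1 mulrCA divff // mulr1.
rewrite -[F 1 _]K2 ?binorm_ge0 // -{1}(K2 (t / s)) // F1E ?powR_ge0 //.
rewrite -{1}[s]K2 ?(ltW s0) // -powRM ?addr_ge0 ?powR_ge0 //.
rewrite mulrDr mulr1 -(powRM _ (ltW s0) ts0).
by have -> : s * (t / s) = t by rewrite mulrCA divff // mulr1.
Qed.

End FunctionalEquation.

(** * Cardinality of small parameter sets *)

Lemma setT_card_leP (T U : Type) (B : set U) :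
  ([set: T] #<= B)%card <->
  exists2 f : T -> U, (forall x, B (f x)) & injective f.
Proof.
split=> [/card_leP[f]|[f fB finj]].
  exists (fun x => val (f (to_setT x))) => [x|x y /val_inj fxy].
    exact: set_valP.
  have /(congr1 val) // : to_setT x = to_setT y.
  by move: fxy; apply: (@inj _ _ _ f); rewrite inE.
have [g] : $|{injfun [set: T] >-> B}|.
  by apply/injfunPex; exists f => // x y _ _ /finj.
exact: inj_card_le g.
Qed.

(** A Hilbert hotel: if [f] embeds [kappa] in the union, the set [Q] of points sent outside [A] is
    countable, so its complement [P] is infinite. Rerouting [Q] into a copy of the natural numbers
    inside [P] embeds [kappa] in [A]. *)
Lemma smallerU_countable (kappa T : Type) (A B : set T) :
  ~ countable [set: kappa] -> countable B -> smaller kappa A ->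
  smaller kappa (A `|` B).
Proof.
move=> kappaNc Bc sA /setT_card_leP[f fAB finj]; apply: sA.
pose P := f @^-1` A; pose Q := ~` P.
have Qc : countable Q.
  apply: (sub_countable _ Bc); apply: card_le_trans (card_ge_preimage (f := f) _).
    by apply: subset_card_le => x NAx; case: (fAB x).
  by move=> x y _ _ /finj.
have Pinf : infinite_set P.
  move=> Pfin; apply: kappaNc.
  rewrite -(setUv P) -bigcup2E; apply: bigcup_countable => // -[|[|i]] _ //=.
  exact: finite_set_countable.
have /infiniteP/setT_card_leP [g gP ginj] := Pinf.
have /countable_injP[h hinj] : countable (Q `|` range g).
  rewrite -bigcup2E; apply: bigcup_countable => // -[|[|i]] _ //=.
  exact: card_image_le.
pose phi x := if pselect ((Q `|` range g) x) then g (h x) else x.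
have phiP x : P (phi x).
  rewrite /phi; case: pselect => [?|N] /=; first exact: gP.
  by apply: contrapT => Qx; apply: N; left.
have phi_inj : injective phi.
  move=> x y; rewrite /phi; case: pselect => Dx; case: pselect => Dy /=.
  - by move=> /ginj; apply: hinj; rewrite inE.
  - by move=> gy; case: Dy; right; exists (h x).
  - by move=> gx; case: Dx; right; exists (h y).
  - by [].
apply/setT_card_leP; exists (f \o phi) => [x|x y /finj/phi_inj//].
exact: phiP.
Qed.

(** * Operations on formulas with parameters *)

Section Formulas.
Context {L : language} {R : realType} {K : scalar_kind}.
Context {C : banach_structure L R K}.
Notation term := (term L (scalar R K)).
Notation pformula := (@pformula L R K C).

Definition tvar (V W : Type) (f : V -> W) (v : V) : term W := TVar L _ (f v).

Definition shift_param (V : Type) (m n : nat) (v : V + 'I_m) :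
    V + 'I_(m + n) :=
  match v with inl x => inl x | inr i => inr (lshift n i) end.

Definition shift_param' (V : Type) (m n : nat) (v : V + 'I_n) :
    V + 'I_(m + n) :=
  match v with inl x => inl x | inr i => inr (rshift m i) end.

Definition cat_params (m n : nat) (f : 'I_m -> C) (g : 'I_n -> C)
    (i : 'I_(m + n)) : C :=
  match fintype.split i with inl j => f j | inr j => g j end.

Definition asg (V : Type) (n : nat) (x : V -> C) (b : 'I_n -> C)
    (v : V + 'I_n) : C :=
  match v with inl w => x w | inr i => b i end.

Lemma asg_shift (V : Type) m n (x : V -> C) (f : 'I_m -> C) (g : 'I_n -> C) v :
  asg x (cat_params f g) (shift_param n v) = asg x f v.
Proof.
case: v => //= i.
by rewrite /cat_params -[lshift _ _]/(unsplit (inl i)) unsplitK.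
Qed.

Lemma asg_shift' (V : Type) m n (x : V -> C) (f : 'I_m -> C) (g : 'I_n -> C) v :
  asg x (cat_params f g) (shift_param' m v) = asg x g v.
Proof.
case: v => //= i.
by rewrite /cat_params -[rshift _ _]/(unsplit (inr i)) unsplitK.
Qed.

Lemma cat_params_in (A : set C) m n (f : 'I_m -> C) (g : 'I_n -> C) :
  (forall i, A (f i)) -> (forall i, A (g i)) -> forall i, A (cat_params f g i).
Proof. by move=> Af Ag i; rewrite /cat_params; case: fintype.split. Qed.

Definition psubst (V : Type) (n : nat) (b : 'I_n -> C) (t : term (V + 'I_n))
    (phi : pformula unit) : pformula V :=
  PFormula (fsubst (body phi) (fun v => match v with
      | inl _ => tsubst (tvar (shift_param (nparams phi))) t
      | inr i => tvar (@shift_param' V n (nparams phi)) (inr i)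
      end)) (cat_params b (params (p := phi))).

Lemma value_psubst (V : Type) (n : nat) (b : 'I_n -> C) (t : term (V + 'I_n))
    (phi : pformula unit) (x : V -> C) :
  value (psubst b t phi) x = value1 phi (teval (asg x b) t).
Proof.
rewrite /value1 /value feval_fsubst; congr feval; apply/funext => -[u|i].
  rewrite teval_tsubst; congr teval; apply/funext => v /=.
  exact: (asg_shift x b).
exact: (asg_shift' x b (params (p := phi)) (inr i)).
Qed.

Lemma over_psubst (A : set C) (V : Type) (n : nat) (b : 'I_n -> C)
    (t : term (V + 'I_n)) (phi : pformula unit) :
  (forall i, A (b i)) -> over A phi -> over A (psubst b t phi).
Proof. exact: cat_params_in. Qed.

Definition pconn2 (V : Type) (u : 'rV[R]_2 -> R) (cu : continuous u)
    (phi psi : pformula V) : pformula V :=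
  PFormula (FConn cu (fun i => if i == ord0
      then fsubst (body phi) (tvar (shift_param (nparams psi)))
      else fsubst (body psi) (tvar (@shift_param' V (nparams phi) _))))
    (cat_params (params (p := phi)) (params (p := psi))).

Lemma value_pconn2 (V : Type) u (cu : continuous u) (phi psi : pformula V) x :
  value (pconn2 cu phi psi) x =
    u (\row_i if i == ord0 then value phi x else value psi x).
Proof.
rewrite /value /=; congr u; apply/rowP => i; rewrite !mxE.
case: ifP => _; rewrite feval_fsubst; congr feval; apply/funext => v /=.
  exact: (asg_shift x (params (p := phi))).
exact: (asg_shift' x (params (p := phi))).
Qed.

Lemma over_pconn2 (A : set C) (V : Type) u (cu : continuous u)
    (phi psi : pformula V) :
  over A phi -> over A psi -> over A (pconn2 cu phi psi).
Proof. exact: cat_params_in. Qed.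

Definition dist_add (v : R) (w : 'rV[R]_2) : R := `|w 0 0 - v| + w 0 1.

Lemma dist_add_continuous v : continuous (dist_add v).
Proof.
move=> w; apply: (@continuousD _ _ _ (fun w : 'rV[R]_2 => `|w 0 0 - v|)).
  apply: (@continuous_comp _ _ _ (fun w : 'rV[R]_2 => w 0 0 - v) Num.norm).
    by apply: continuousB; [exact: coord_continuous|exact: cst_continuous].
  exact: norm_continuous.
exact: coord_continuous.
Qed.

(** [saturated] knows only conditions of the form value = 0; this truncation vanishes exactly when
    the first entry is within [e] of [v]. *)
Definition dist_cut (v e : R) (w : 'rV[R]_2) : R := Num.max (`|w 0 0 - v| - e) 0.

Lemma dist_cut_continuous v e : continuous (dist_cut v e).
Proof.
move=> w; apply: (@continuous_max R _ (fun w : 'rV[R]_2 => `|w 0 0 - v| - e)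
  (fun=> 0)); last exact: cst_continuous.
apply: continuousB; last exact: cst_continuous.
apply: (@continuous_comp _ _ _ (fun w : 'rV[R]_2 => w 0 0 - v) Num.norm).
  by apply: continuousB; [exact: coord_continuous|exact: cst_continuous].
exact: norm_continuous.
Qed.

Definition pzero : pformula unit :=
  @PFormula _ _ _ C unit 0 (FNorm R (TZero L _ _)) (fun=> 0).

Lemma value_pzero x : value1 pzero x = 0.
Proof. exact: nrm0. Qed.

(** An l_1 distance to prescribed values: it packs finitely many conditions into one formula, since
    [finitely_satisfiable] takes formulas one at a time. *)
Definition pdist_sum (val : pformula unit -> R) (l : seq (pformula unit)) :
    pformula unit :=
  foldr (fun phi => pconn2 (@dist_add_continuous (val phi)) phi) pzero l.

Lemma value_pdist_sum val l x :
  value1 (pdist_sum val l) x = \sum_(phi <- l) `|value1 phi x - val phi|.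
Proof.
elim: l => [|phi l IH] /=; first by rewrite big_nil value_pzero.
by rewrite big_cons -IH /value1 value_pconn2 /dist_add !mxE.
Qed.

Lemma over_pdist_sum A val l :
  (forall phi, List.In phi l -> over A phi) -> over A (pdist_sum val l).
Proof.
elim: l => [|phi l IH] Al /=; first by case.
by apply: over_pconn2; [apply: Al; left|apply: IH => psi ?; apply: Al; right].
Qed.

Lemma le_sum_In (T : Type) (l : seq T) (f : T -> R) x :
  (forall y, 0 <= f y) -> List.In x l -> f x <= \sum_(y <- l) f y.
Proof.
move=> f0; elim: l => //= y l IH [->|xl]; rewrite big_cons.
  by rewrite lerDl sumr_ge0.
by rewrite (le_trans (IH xl)) // lerDr.
Qed.

Lemma finitely_satisfiable_list (M A : set C) b l (e : R) :
  finitely_satisfiable M A b -> (forall phi, List.In phi l -> over A phi) ->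
  0 < e ->
  exists2 m, M m & forall phi, List.In phi l ->
    `|value1 phi m - value1 phi b| < e.
Proof.
move=> fs Al e0; pose val phi := value1 phi b.
have [m Mm] := fs _ (@over_pdist_sum A val l Al) _ e0.
rewrite !value_pdist_sum [X in _ - X]big1 => [|phi _]; last first.
  by rewrite subrr normr0.
rewrite subr0 ger0_norm ?sumr_ge0 // => lt_e; exists m => // phi phil.
apply: le_lt_trans lt_e.
exact: (@le_sum_In _ _ (fun phi => `|value1 phi m - val phi|)).
Qed.

Definition pcut (v e : R) (phi : pformula unit) : pformula 'I_1 :=
  let phi1 := psubst (fun=> 0) (TVar L _ (inl ord0 : 'I_1 + 'I_0)%type) phi in
  pconn2 (@dist_cut_continuous v e) phi1 phi1.

Lemma value_pcut v e phi (x : 'I_1 -> C) :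
  value (pcut v e phi) x = Num.max (`|value1 phi (x ord0) - v| - e) 0.
Proof. by rewrite value_pconn2 /dist_cut !mxE /= value_psubst. Qed.

Lemma pcut_eq0 v e phi (x : 'I_1 -> C) :
  value (pcut v e phi) x = 0 <-> `|value1 phi (x ord0) - v| <= e.
Proof.
rewrite value_pcut; split=> [H|H]; last by apply: max_r; rewrite subr_le0.
by rewrite -subr_le0 -H le_max lexx.
Qed.

Lemma over_pcut A v e phi : over A phi -> over A (pcut v e phi).
Proof. by move=> ?; apply: over_pconn2; apply: over_psubst => // -[]. Qed.

End Formulas.

Lemma finite_set_list (T : Type) (F : set T) :
  finite_set F -> exists l : seq T, forall x, F x <-> List.In x l.
Proof.
move=> /(@finite_seqP {classic T}) [s ->]; exists s => x /=.
elim: s => //= y s IH; rewrite inE -IH; split=> [/orP[/eqP->|]|[->|->]];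
  by [left|right|rewrite eqxx|rewrite orbT].
Qed.

Lemma list_finite_set (T : Type) (l : seq T) :
  finite_set [set x | List.In x l].
Proof.
elim: l => [|y l IH].
  by rewrite (_ : [set _ | _] = set0) // -subset0 => x [].
rewrite (_ : [set _ | _] = [set y] `|` [set x | List.In x l]).
  by rewrite finite_setU.
by apply/seteqP; split=> x [|]; by [left|right].
Qed.

(** * Saturation and homogeneity of the monster *)

Section Monster.
Context {L : language} {R : realType} {K : scalar_kind}.
Context {C : banach_structure L R K}.
Notation term := (term L (scalar R K)).
Notation pformula := (@pformula L R K C).
Implicit Types (A M : set C) (p q : pretype C) (a b c d x : C).

(* A pair [(phi, v)] stands for the condition [phi = v]. *)
Lemma saturated_list (kappa : Type) A (N : nat) (G : set (pformula unit * R)) :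
  saturated C kappa -> smaller kappa A ->
  (forall g, G g -> over A g.1) ->
  (forall l (e : R), (forall g, List.In g l -> G g) -> 0 < e ->
     exists x, nrm x <= N%:R /\
       forall g, List.In g l -> `|value1 g.1 x - g.2| < e) ->
  exists x, forall g, G g -> value1 g.1 x = g.2.
Proof.
move=> sat sA GA Gfin.
(* Finite lists are satisfied only approximately, whereas saturation asks for exact zeros; each
   condition is therefore split into the weaker ones |phi - v| <= 1/(n+1). *)
pose G' := [set psi : pformula 'I_1 | exists g (n : nat),
  G g /\ psi = pcut g.2 n.+1%:R^-1 g.1].
have G'list l : (forall psi, List.In psi l -> G' psi) ->
    exists l' (e : R), [/\ forall g, List.In g l' -> G g, 0 < e &
      forall x, (forall g, List.In g l' -> `|value1 g.1 x - g.2| < e) ->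
        forall psi, List.In psi l -> value psi (fun=> x) = 0].
  elim: l => [|psi l IH] Gl; first by exists [::], 1; split.
  have [|l' [e [l'G e0 l'l]]] := IH; first by move=> ? ?; apply: Gl; right.
  have [|g [n [Gg ->]]] := Gl psi; first by left.
  exists (g :: l'), (Num.min e n.+1%:R^-1); split.
  - by move=> h [<-|/l'G].
  - by rewrite lt_min e0 invr_gt0 ltr0n.
  - move=> x xl psi' [<-|psil].
      apply/pcut_eq0; apply/ltW.
      by have := xl g (or_introl erefl); rewrite lt_min => /andP[].
    apply: l'l psil => h hl'.
    by have := xl h (or_intror hl'); rewrite lt_min => /andP[].
have [psi|F /finite_set_list[l Fl] FG'|x [_ xG']] := sat A 1%N G' N sA.
- by move=> [g [n [Gg ->]]]; apply: over_pcut; exact: GA.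
- have [psi /Fl/FG'//|l' [e [l'G e0 l'l]]] := G'list l.
  have [x [xN xl']] := Gfin _ _ l'G e0.
  by exists (fun=> x); split=> // psi /Fl; exact: l'l.
exists (x ord0) => g Gg.
apply/eqP; rewrite -subr_eq0 -normr_eq0 eq_le normr_ge0 andbT.
apply: (@le_natr_bounded _ _ 1) => -[|n]; first by rewrite mul0r.
have /xG'/pcut_eq0 : G' (pcut g.2 n.+1%:R^-1 g.1) by exists g, n.
by rewrite mulrC -ler_pdivlMr ?ltr0n // mul1r.
Qed.

Lemma realize_global_type (kappa : Type) A q :
  monster C kappa -> smaller kappa A -> is_type setT q ->
  exists x, realizes A q x.
Proof.
move=> [_ _ sat _] sA [N qN].
have [||x xq] := @saturated_list kappa A N
    [set g | over A g.1 /\ g.2 = q g.1] sat sA; [by move=> g []| |].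
  move=> l e lG e0.
  have [|x [xN xl]] := qN [set phi | List.In phi (map fst l)]
      (list_finite_set _) _ e e0; first by [].
  exists x; split=> // g gl; have [_ ->] := lG g gl.
  by apply: xl; apply: List.in_map.
by exists x => phi phiA; apply: (xq (phi, q phi)).
Qed.

Lemma realizes_sub A A' q x : A `<=` A' -> realizes A' q x -> realizes A q x.
Proof. by move=> AA' xq phi phiA; apply: xq => i; apply/AA'/phiA. Qed.

(** Strong homogeneity is applied to the map that sends [b] to [d] and is the identity on [M]. *)
Lemma realizes_conj (kappa : Type) M p b d :
  monster C kappa -> M 0 -> smaller kappa M -> realizes M p b -> realizes M p d ->
  exists s, [/\ automorphism s, forall x, M x -> s x = x & s b = d].
Proof.
move=> [kappaNc _ _ hom] M0 sM pb pd.
pose f x := if x == b then d else x.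
(* If [b] lies in [M], the formula |x - b| over [M] forces [d = b]. *)
have fM x : M x -> f x = x.
  rewrite /f; case: eqP => // -> Mb; apply/eqP; rewrite -subr_eq0; apply/eqP.
  apply: nrm_eq0; pose phi : pformula unit := PFormula (FNorm R
    (TAdd (TVar L _ (inl tt)) (TScale (-1) (TVar L _ (inr ord0 : unit + 'I_1)))))
    (fun=> b).
  have phiM : over M phi by [].
  have := pb phi phiM; rewrite -(pd phi phiM) /value1 /value /= !scaleN1r subrr.
  by rewrite nrm0 => <-.
have [||s [sa sE]] := hom (M `|` [set b]) f.
- by apply: smallerU_countable => //; exact: countable1.
- move=> n phi e eM.
  (* The slots holding [b] become the variable; the parameters left vacant are filled with 0, an
     element of [M]. *)
  pose psi : pformula unit := PFormula (fsubst phi (fun i =>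
      TVar L _ (if e i == b then inl tt else inr i)))
    (fun i => if e i == b then 0 else e i).
  have psiM : over M psi.
    move=> i /=; case: ifP => [_|/eqP eib]; first exact: M0.
    by case: (eM i) => // /eib.
  have psiE x :
      value1 psi x = feval setT (fun i => if e i == b then x else e i) phi.
    rewrite /value1 /value feval_fsubst; congr feval.
    by apply/funext => i /=; case: ifP => //= ->.
  have := pb psi psiM; rewrite -(pd psi psiM) !psiE => dE.
  have -> : e = fun i => if e i == b then b else e i.
    by apply/funext => i; case: eqP.
  rewrite dE; congr feval; apply/funext => i /=.
  by rewrite /f; have [_|/negPf eib] := eqVneq (e i) b; rewrite /= ?eqxx ?eib.

exists s; split=> //; first by move=> x Mx; rewrite sE ?fM //; left.
by rewrite sE /f ?eqxx //; right.
Qed.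
End Monster.

(** * Morley sequences and coheirs *)

Definition stable_along_morley (L : language) (R : realType) (K : scalar_kind)
    (C : banach_structure L R K) (M : set C) (q : pretype C) : Prop :=
  forall (I : Type) (lt : I -> I -> Prop) (a : I -> C),
    well_order lt -> morley_sequence M q lt a ->
    forall phi : pformula C unit, exists v : R, forall e : R, 0 < e ->
      finite_set [set i | e <= `|value1 phi (a i) - v|].

(** Order type omega + omega: a second infinite block can be chosen generic over an element found
    after the first block. *)
Definition lt_sum (i j : nat + nat) : Prop :=
  match i, j with
  | inl m, inl n => (m < n)%N
  | inl _, inr _ => True
  | inr _, inl _ => False
  | inr m, inr n => (m < n)%N
  end.

Lemma well_order_lt_sum : well_order lt_sum.
Proof.
have accl n : Acc lt_sum (inl n).
  elim/ltn_ind: n => n IH; constructor => -[m|m] /= mn; [exact: IH|case: mn].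
have accr n : Acc lt_sum (inr n).
  elim/ltn_ind: n => n IH; constructor => -[m|m] /= mn; [exact: accl|exact: IH].
split; first by move=> [n|n]; [exact: accl|exact: accr].
- by move=> [i|i] [j|j] [l|l] //=; exact: ltn_trans.
- move=> [i|i] [j|j] /=; try by [constructor 1|constructor 3].
  + by have [?|?|->] := ltngtP i j; [constructor 1|constructor 3|constructor 2].
  + by have [?|?|->] := ltngtP i j; [constructor 1|constructor 3|constructor 2].
Qed.

Section Coheirs.
Context {L : language} {R : realType} {K : scalar_kind}.
Context {C : banach_structure L R K}.
Notation term := (term L (scalar R K)).
Notation pformula := (@pformula L R K C).
Implicit Types (A M : set C) (p q : pretype C) (a b c d x : C) (r s : R).

(** Choosing a realization over every finite list turns the recursion on all earlier terms into an
    iteration on lists. *)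
Lemma morley_extend (kappa : Type) A q :
  monster C kappa -> smaller kappa A -> is_type setT q ->
  exists c : nat -> C, forall n,
    realizes (A `|` [set c j | j in [set j | (j < n)%N]]) q (c n).
Proof.
move=> mC sA tq.
have /choice[g gP] : forall l : seq C, exists x, realizes (A `|` [set` l]) q x.
  move=> l; apply: (realize_global_type mC _ tq).
  case: mC => kappaNc _ _ _; apply: smallerU_countable => //.
  by apply/finite_set_countable/finite_seqP; exists l.
pose l n := iter n (fun w => g w :: w) [::].
exists (g \o l) => n; apply: realizes_sub (gP (l n)); apply: setUS.
move=> _ [j /= jn <-]; elim: n jn => //= n IH; rewrite ltnS leq_eqVlt inE.
by move=> /orP[/eqP->|/IH ->]; rewrite ?eqxx ?orbT.
Qed.

Definition pnorm2 (r s : R) (b : C) : pformula unit :=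
  PFormula (FNorm R (TAdd
    (TScale (of_real K r) (TVar L _ (inl tt)))
    (TScale (of_real K s) (TVar L _ (inr ord0 : unit + 'I_1)%type)))) (fun=> b).

Lemma value_pnorm2 r s b x :
  value1 (pnorm2 r s b) x = nrm (of_real K r *: x + of_real K s *: b).
Proof. by []. Qed.

Lemma value_pnorm2C r s b x : value1 (pnorm2 r s b) x = value1 (pnorm2 s r x) b.
Proof. by rewrite !value_pnorm2 addrC. Qed.

Lemma invariant_pnorm2 (kappa : Type) M p q r s b d :
  monster C kappa -> M 0 -> smaller kappa M -> invariant M q ->
  realizes M p b -> realizes M p d -> q (pnorm2 r s b) = q (pnorm2 r s d).
Proof.
move=> mC M0 sM qM pb pd.
have [f [fa fM <-]] := realizes_conj mC M0 sM pb pd.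
by rewrite -(qM f fa fM).
Qed.

Lemma limit_const (T : Type) (h : nat -> T) (f : T -> R) (u v : R) :
  injective h -> (forall n, f (h n) = u) ->
  (forall e, 0 < e -> finite_set [set i | e <= `|f i - v|]) -> u = v.
Proof.
move=> hinj fu fin; apply/eqP; rewrite -subr_eq0 -normr_eq0; apply/negPn/negP.
move=> uv; have e0 : 0 < `|u - v| by rewrite lt_neqAle eq_sym uv normr_ge0.
apply: infinite_nat; have /(finite_preimage (f := h)) := fin _ e0.
rewrite (_ : _ @^-1` _ = setT); last first.
  by apply/seteqP; split=> // n _ /=; rewrite fu.
by apply=> m n _ _ /hinj.
Qed.

(* A coheir [b] of [p] over [M a] can be replaced by some [d] with
   [r c_n + s d] of the same norm for all terms of a Morley sequence; prolonging
   the sequence by realizations of [q] over [d] then reveals that norm. *)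
Lemma coheir_norm (kappa : Type) M p q r s a b :
  monster C kappa -> M 0 -> smaller kappa M -> is_type setT q ->
  (forall phi, over M phi -> q phi = p phi) -> invariant M q ->
  stable_along_morley M q ->
  realizes M p a -> realizes M p b ->
  finitely_satisfiable M (M `|` [set a]) b ->
  nrm (of_real K r *: a + of_real K s *: b) = q (pnorm2 r s b).
Proof.
move=> mC M0 sM tq qp qM st pa pb fsb.
have [c cP] := morley_extend mC sM tq.
have cM n : realizes M p (c n).
  move=> phi phiM; rewrite -qp //.
  by apply: (realizes_sub _ (cP n)) phiM => x; left.
have [kappaNc _ sat _] := mC.
rewrite -value_pnorm2; set alpha := value1 _ _.
have sMc : smaller kappa (M `|` range c).
  by apply: smallerU_countable => //; exact: card_image_le.
(* By saturation some [d] stands to every [c n] as [b] stands to [a]. *)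
have [d [pd dc]] : exists d, realizes M p d /\
    forall n, value1 (pnorm2 r s d) (c n) = alpha.
  pose N := (Num.trunc (nrm b)).+2.
  pose G := [set g : pformula unit * R | (over M g.1 /\ g.2 = p g.1) \/
    exists n, g = (pnorm2 s r (c n), alpha)].
  have [g [[gM _] i|[n ->] i]|l e lG e0|d dG] :=
      @saturated_list _ _ _ _ kappa (M `|` range c) N G sat sMc.
  - by left; exact: gM.
  - by right; exists n.
  (* For m in [M], |r c_n + s m| = |r a + s m| because [c n] and [a] both realize [p]. Conditions on
     [c n] can thus be tested at [a], where the type of [b] is finitely satisfiable in [M]. *)
  - have [l' [l'M l'l]] : exists l' : seq (pformula unit),
        (forall phi, List.In phi l' -> over (M `|` [set a]) phi) /\
        forall m, M m ->
          (forall phi, List.In phi l' -> `|value1 phi m - value1 phi b| < e) ->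
          forall g, List.In g l -> `|value1 g.1 m - g.2| < e.
      elim: l lG => [|g l IH] lG; first by exists [::]; split.
      have [|l' [l'M l'l]] := IH; first by move=> h hl; apply: lG; right.
      case: (lG g (or_introl erefl)) => [[gM gE]|[n gE]].
        exists (g.1 :: l'); split=> [phi [<- i|/l'M//]|m Mm ml' h [<-|hl]].
        - by left; exact: gM.
        - by rewrite gE -(pb _ gM); apply: ml'; left.
        - by apply: l'l hl => // phi ?; apply: ml'; right.
      exists (pnorm2 s r a :: l'); split=> [phi [<- i|/l'M//]|m Mm ml' h [<-|hl]].
      - by right.
      - rewrite gE /= value_pnorm2C.
        have mM : over M (pnorm2 r s m) by [].
        rewrite (cM n _ mM) -(pa _ mM) /alpha !(value_pnorm2C r s).
        by apply: ml'; left.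
      - by apply: l'l hl => // phi ?; apply: ml'; right.
    (* [pnorm2 1 0 0] is the norm of the variable; keeping |m| within 1 of |b| puts m in the ball of
       radius [N] demanded by saturation. *)
    have [phi||m Mm ml'] := @finitely_satisfiable_list _ _ _ _ M _ b
      (pnorm2 1 0 0 :: l') (Num.min e 1) fsb.
    + by case=> [<- i|/l'M//]; left.
    + by rewrite lt_min e0 ltr01.
    exists m; split; last first.
      apply: l'l => // phi phil; have := ml' phi (or_intror phil).
      by rewrite lt_min => /andP[].
    have := ml' _ (or_introl erefl).
    rewrite !value_pnorm2 of_real0 of_real1 !scale1r scale0r !addr0 lt_min.
    move=> /andP[_ mb]; apply/ltW.
    have /andP[_ bN] := truncn_itv (nrm_ge0 b).
    have := ler_norm (nrm m - nrm b); rewrite /N -natr1; lra.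
  - exists d; split=> [phi phiM|n]; first by apply: (dG (phi, p phi)); left.
    by rewrite value_pnorm2C; apply: (dG (_, _)); right; exists n.
have sMcd : smaller kappa ((M `|` range c) `|` [set d]).
  by apply: smallerU_countable => //; exact: countable1.
(* The second block realizes [q] also over [d], so the formula has there the constant value
   [q (pnorm2 r s d)], against [alpha] on the first block; stability equates the two. *)
have [c' c'P] := morley_extend mC sMcd tq.
pose z i := match i with inl n => c n | inr n => c' n end.
have zM : morley_sequence M q lt_sum z.
  move=> [n|n] /=.
    by apply: realizes_sub (cP n); apply: setUS => _ [[m|m] //= mn <-]; exists m.
  apply: realizes_sub (c'P n); rewrite -!setUA; apply: setUS.
  move=> _ [[m|m] //= mn <-]; first by left; exists m.
  by right; right; exists m.
have [v vP] := st _ _ _ well_order_lt_sum zM (pnorm2 r s d).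
have -> : alpha = v.
  by apply: (@limit_const _ inl (fun i => value1 (pnorm2 r s d) (z i))
    alpha v _ dc vP) => x y [].
apply/esym; apply: (@limit_const _ inr (fun i => value1 (pnorm2 r s d) (z i))
  _ v _ _ vP) => [x y []//|n] /=.
rewrite (invariant_pnorm2 _ _ mC M0 sM qM pb pd); apply: c'P => i.
by left; right.
Qed.

(** At m in [M] in place of [a n] the equality holds because x/|x| and [a 0] realize the same type
    over [M]. Both norms are formulas over [M a_<n] ([a 0] is among the parameters by [0 < n]), so
    finite satisfiability carries it to [a n]. *)
Lemma coheir_sum M p (a : nat -> C) n (u : 'I_n -> R) r :
  let x := \sum_(i < n) of_real K (u i) *: a i in
  (forall i, realizes M p (a i)) ->
  finitely_satisfiable M (M `|` [set a i | i in [set i | (i < n)%N]]) (a n) ->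
  (0 < n)%N -> nrm x != 0 -> realizes M p (of_real K (nrm x)^-1 *: x) ->
  nrm (x + of_real K r *: a n) =
    nrm (of_real K (nrm x) *: a 0%N + of_real K r *: a n).
Proof.
move=> x pa fsa n0 x0 px.
pose phi : pformula unit := PFormula (FNorm R (TAdd
    (\big[@TAdd L _ _/TZero L _ _]_(i < n)
        TScale (of_real K (u i)) (TVar L _ (inr i : unit + 'I_n)%type))
    (TScale (of_real K r) (TVar L _ (inl tt))))) (fun i => a i).
have phiE y : value1 phi y = nrm (x + of_real K r *: y).
  by rewrite /value1 /value /= teval_sum.
pose psi := pnorm2 r (nrm x) (a 0%N).
have eqM m : M m -> value1 phi m = value1 psi m.
  move=> Mm; have mM : over M (pnorm2 (nrm x) r m) by [].
  have := px _ mM; rewrite -(pa 0%N _ mM) value_pnorm2 scalerA -of_realM.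
  by rewrite divff // of_real1 scale1r phiE => ->; rewrite value_pnorm2C.
rewrite -phiE [X in _ = nrm X]addrC -[RHS]/(value1 psi (a n)).
apply/eqP; rewrite -subr_eq0 -normr_eq0 eq_le normr_ge0 andbT.
apply/ler_addgt0Pr => /= e e0; rewrite add0r.
have [chi||m Mm me] := @finitely_satisfiable_list _ _ _ _ M _ _
      [:: phi; psi] (e / 2) fsa.
- by case=> [<- i|[<- i|//]] /=; right; [exists i|exists 0%N] => //=.
- by rewrite divr_gt0.
have := me phi (or_introl erefl); have := me psi (or_intror (or_introl erefl)).
rewrite (eqM m Mm).
move: (value1 phi (a n)) (value1 psi (a n)) (value1 psi m) => A B D.
rewrite !ltr_norml => /andP[? ?] /andP[? ?]; rewrite ler_norml; apply/andP.
by split; lra.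
Qed.

(** Transitivity of coheirs: [b] is first replaced by some [m2] in [M], over [A] and [a]. As [M] is
    contained in [A], [m2] is an admissible parameter when [a] is replaced in turn. *)
Lemma finitely_satisfiable_comb M A (a b : C) r s :
  M `<=` A -> (forall x y, M x -> M y -> M (of_real K r *: x + of_real K s *: y)) ->
  finitely_satisfiable M A a -> finitely_satisfiable M (A `|` [set a]) b ->
  finitely_satisfiable M A (of_real K r *: a + of_real K s *: b).
Proof.
move=> MA Mlin fsa fsb phi phiA e e0.
pose t : term (unit + 'I_1) := TAdd
  (TScale (of_real K r) (TVar L _ (inr ord0)))
  (TScale (of_real K s) (TVar L _ (inl tt))).
pose t' : term (unit + 'I_1) := TAdd
  (TScale (of_real K r) (TVar L _ (inl tt)))
  (TScale (of_real K s) (TVar L _ (inr ord0))).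
have e20 : 0 < e / 2 by rewrite divr_gt0.
have [|m2 Mm2] := fsb (psubst (fun=> a) t phi) _ _ e20.
  by apply: over_psubst => [_|i]; [right|left; exact: phiA].
rewrite /value1 !value_psubst /= => m2P.
have [|m1 Mm1] := fsa (psubst (fun=> m2) t' phi) _ _ e20.
  by apply: over_psubst => // _; exact: MA.
rewrite /value1 !value_psubst /= => m1P.
exists (of_real K r *: m1 + of_real K s *: m2); first exact: Mlin.
move: m1P m2P; rewrite !ltr_norml => /andP[u1 u2] /andP[u3 u4].
by apply/andP; split; move: u1 u2 u3 u4; rewrite /value1; lra.
Qed.

End Coheirs.

(** [0] is not neutral for [Num.max] on all of [R], so the last term is split off by comparing upper
    bounds. *)
Lemma bigmax_ord_recr (R : realType) (n : nat) (x : 'I_n.+1 -> R) :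
  (forall i, 0 <= x i) ->
  \big[Num.max/0]_(i < n.+1) x i =
    Num.max (\big[Num.max/0]_(i < n) x (widen_ord (leqnSn n) i)) (x ord_max).
Proof.
move=> x0; apply/eqP; rewrite eq_le ge_max; apply/and3P; split.
- apply/bigmax_leP; split=> [|i _]; first by rewrite le_max bigmax_ge_id.
  have [->|iN] := eqVneq i ord_max; first by rewrite le_max lexx orbT.
  have iltn : (i < n)%N by rewrite ltn_neqAle iN -ltnS /=.
  rewrite le_max; apply/orP; left; apply: (bigmax_sup (Ordinal iltn)) => //.
  by rewrite (_ : widen_ord _ _ = i) //; apply: val_inj.
- by apply/bigmax_leP; split=> [|i _]; [exact: bigmax_ge_id|exact: le_bigmax].
- exact: le_bigmax.
Qed.

(** * The two-variable norm of a generic wide sequence *)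

Section GenericWideSequence.
Context {L : language} {R : realType} {K : scalar_kind} {kappa : Type}.
Context {C : banach_structure L R K} {M : set C} {p : pretype C} {a : nat -> C}.
Hypothesis monsterC : monster C kappa.
Hypothesis elemM : elementary_substructure M.
Hypothesis smallM : smaller kappa M.
Hypothesis stable_p : generically_stable M p.
Hypothesis generic_a : generic_wide_sequence M p a.

Let F (s t : R) : R := nrm (of_real K s *: a 0%N + of_real K t *: a 1%N).

Lemma indiscernible_pair i j s t : (i < j)%N ->
  nrm (of_real K s *: a i + of_real K t *: a j) = F s t.
Proof.
move=> ij; have [[ind _ _] _] := generic_a.
pose h m n (k : 'I_2) := if k == ord0 then m else n : nat.
have hS m n : (m < n)%N -> {homo h m n : k l / (k < l)%N}.
  by move=> mn [[|[|k]] Hk] [[|[|l]] Hl].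
pose phi : formula L R (scalar R K) 'I_2 := FNorm R (TAdd
  (TScale (of_real K s) (TVar L _ ord0))
  (TScale (of_real K t) (TVar L _ ord_max))).
exact: (ind 2 (h i j) (h 0%N 1%N) (hS _ _ ij) (hS 0%N 1%N isT) phi).
Qed.

Lemma realizes_comb (B : set C) x : subspace B -> sphere B `<=` realizations M p ->
  B x -> nrm x != 0 -> realizes M p (of_real K (nrm x)^-1 *: x).
Proof.
move=> [B0 BL] Bp Bx x0; apply: Bp; split.
  by rewrite -[_ *: x]addr0; exact: BL.
by rewrite nrmZ ger0_norm ?invr_ge0 ?nrm_ge0 // mulVf.
Qed.

Lemma sum_in (B : set C) (I : Type) (l : seq I) (u : I -> scalar R K) (x : I -> C) :
  subspace B -> (forall i, B (x i)) -> B (\sum_(i <- l) u i *: x i).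
Proof.
move=> [B0 BL] Bx; elim: l => [|i l IH]; first by rewrite big_nil.
by rewrite big_cons; exact: BL.
Qed.

Lemma nrm_a i : nrm (a i) = 1.
Proof. by have [[_ _ [B [_ _ Ba _]]] _] := generic_a; have [] := Ba i. Qed.

Lemma pair_norm0l t : F 0 t = `|t|.
Proof. by rewrite /F of_real0 scale0r add0r nrmZ nrm_a mulr1. Qed.

Lemma pair_norm0r s : F s 0 = `|s|.
Proof. by rewrite /F of_real0 scale0r addr0 nrmZ nrm_a mulr1. Qed.

Lemma nrm_sum_recr n (u : 'I_n.+1 -> R) :
  nrm (\sum_(i < n.+1) of_real K (u i) *: a i) =
    F (nrm (\sum_(i < n) of_real K (u (widen_ord (leqnSn n) i)) *: a i))
      (u ord_max).
Proof.
rewrite big_ord_recr /=; set x := \sum_(i < n) _.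
(* A zero partial sum cannot be normalized to a realization of [p]. *)
have [x0|x0] := eqVneq (nrm x) 0.
  by rewrite x0 pair_norm0l (nrm_eq0 x0) add0r nrmZ nrm_a mulr1.
have n0 : (0 < n)%N.
  by case: n u @x x0 => // u x; rewrite /x big_ord0 nrm0 eqxx.
have [[_ pa [B [SB _ Ba Bp]]] fsa] := generic_a.
rewrite (coheir_sum (M := M) (p := p)) ?indiscernible_pair //.
apply: (realizes_comb SB Bp _ x0).
by apply: (sum_in _ _ SB) => i; case: (Ba i).
Qed.

Lemma pair_normN s t : F (- s) (- t) = F s t.
Proof. by rewrite /F !of_realN !scaleNr -opprD nrmN. Qed.

(** In the two-term case of [nrm_sum_recr] the first partial sum is u a_0, whose norm |u| forgets
    the sign. *)
Lemma pair_normNl s t : F (- s) t = F s t.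
Proof.
have H u : F u t = F `|u| t.
  have := nrm_sum_recr (fun i : 'I_2 => if i == ord0 then u else t).
  rewrite !big_ord_recr !big_ord0 /= !add0r -/(F u t) => ->.
  by rewrite nrmZ nrm_a mulr1.
by rewrite H normrN -H.
Qed.

Lemma pair_normNr s t : F s (- t) = F s t.
Proof. by rewrite -pair_normN opprK pair_normNl. Qed.

Lemma pair_normZ c s t : 0 <= c -> F (c * s) (c * t) = c * F s t.
Proof.
move=> c0; rewrite /F !of_realM -!scalerA -scalerDr nrmZ ger0_norm //.
Qed.

Lemma pair_norm_convex l s t s' t' : 0 <= l -> l <= 1 ->
  F (l * s + (1 - l) * s') (l * t + (1 - l) * t') <= l * F s t + (1 - l) * F s' t'.
Proof.
move=> l0 l1; rewrite -!pair_normZ ?subr_ge0 // /F.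
apply: le_trans (nrmD _ _); rewrite le_eqVlt; apply/orP; left; apply/eqP.
by congr nrm; rewrite !of_realD !scalerDl addrACA.
Qed.

(** A convex function that is even in each variable increases on the positive quadrant, since v in
    [0, w] is a convex combination of w and -w. *)
Lemma pair_norm_le (s s' t t' : R) : 0 <= s -> s <= s' -> 0 <= t -> t <= t' ->
  F s t <= F s' t'.
Proof.
have le (u v w : R) : 0 <= v -> v <= w -> exists l : R, [/\ 0 <= l, l <= 1 &
    l * u + (1 - l) * u = u /\ v = l * w + (1 - l) * - w].
  move=> v0 vw; have [w0|w0] := eqVneq w 0.
    by exists 1; split=> //; split; [ring|rewrite w0; rewrite w0 in vw; lra].
  have w0' : 0 < w by rewrite lt_neqAle eq_sym w0 (le_trans v0).
  (* The solution l of l w - (1 - l) w = v. *)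
  exists ((1 + v / w) / 2).
  have q0 : 0 <= v / w by rewrite divr_ge0 // ltW.
  have q1 : v / w <= 1 by rewrite ler_pdivrMr // mul1r.
  split; [lra|lra|split; [ring|by field]].
move=> s0 ss t0 tt; apply: (@le_trans _ _ (F s t')).
  have [l [l0 l1 [E1 E2]]] := le s t t' t0 tt.
  rewrite {1}E2 -{1}E1; apply: le_trans (pair_norm_convex _ _ _ _ l0 l1) _.
  rewrite pair_normNr; lra.
have [l [l0 l1 [E1 E2]]] := le t' s s' s0 ss.
rewrite {1}E2 -{1}E1; apply: le_trans (pair_norm_convex _ _ _ _ l0 l1) _.
rewrite pair_normNl; lra.
Qed.

(** Both sides are the norm of r a_0 + s a_1 + t a_2: the left by peeling off [a 2], the right by
    treating s a_1 + t a_2 as a multiple of a single coheir of [p] over [M a_0]. *)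
Lemma pair_normA r s t : 0 <= r -> 0 <= s -> 0 <= t -> F (F r s) t = F r (F s t).
Proof.
move=> r0 s0 t0.
have := nrm_sum_recr (fun i : 'I_3 => nth 0 [:: r; s; t] i).
rewrite !big_ord_recr !big_ord0 /= !add0r -/(F r s) => <-.
rewrite -addrA; set z := of_real K s *: a 1%N + of_real K t *: a 2%N.
have zE : nrm z = F s t by rewrite /z indiscernible_pair.
have [z0|z0] := eqVneq (nrm z) 0.
  by rewrite -zE z0 pair_norm0r (nrm_eq0 z0) addr0 nrmZ nrm_a mulr1.
have [[_ pa [B [SB _ Ba Bp]]] fsa] := generic_a.
have [q [tq qp qM st]] := stable_p.
have [_ [M0 ML] _ _] := elemM.
have Bz : B z.
  rewrite /z -[_ *: a 2]addr0; case: SB => B0 BL.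
  by apply: (BL); [case: (Ba 1%N)|apply: BL => //; case: (Ba 2%N)].
have pb := realizes_comb SB Bp Bz z0.
have set1E : M `|` [set a i | i in [set i | (i < 1)%N]] = M `|` [set a 0%N].
  congr setU; apply/seteqP; split=> [_ [[|//] _ <-] //|_ ->]; by exists 0%N.
have set2E : M `|` [set a i | i in [set i | (i < 2)%N]] =
    (M `|` [set a 0%N]) `|` [set a 1%N].
  rewrite -setUA; congr setU; apply/seteqP; split.
    by move=> _ [[|[|//]] _ <-]; [left|right].
  by move=> _ [->|->]; [exists 0%N|exists 1%N].
have fs1 : finitely_satisfiable M (M `|` [set a 0%N]) (a 1%N).
  by rewrite -set1E; exact: fsa.
have fsb : finitely_satisfiable M (M `|` [set a 0%N])
    (of_real K (nrm z)^-1 *: z).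
  rewrite /z scalerDr !scalerA -!of_realM; apply: finitely_satisfiable_comb => //.
  - by move=> x y Mx My; apply: (ML) => //; rewrite -[_ *: y]addr0; apply: ML.
  - by rewrite -set2E; exact: fsa.
(* The normalized [z] and [a 1] are both coheirs of [p] over [M a_0]; [q], being invariant,
   prescribes the same norm for the two. *)
have norm_z := coheir_norm r (nrm z) monsterC M0 smallM tq qp qM st (pa 0%N) pb fsb.
have norm_1 := coheir_norm r (nrm z) monsterC M0 smallM tq qp qM st (pa 0%N) (pa 1%N) fs1.
move: norm_z; rewrite scalerA -of_realM divff // of_real1 scale1r => ->.
rewrite (invariant_pnorm2 _ _ monsterC M0 smallM qM pb (pa 1%N)) -norm_1.
by rewrite zE.
Qed.

Lemma pair_norm11_le : F 1 1 <= 2.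
Proof. by apply: le_trans (nrmD _ _) _; rewrite !nrmZ !nrm_a normr1 !mulr1. Qed.

Lemma nrm_sum_fold (N : forall k, ('I_k -> R) -> R) :
  (forall u, N 0%N u = 0) ->
  (forall k (u : 'I_k.+1 -> R), N k.+1 u =
     F (N k (fun i => u (widen_ord (leqnSn k) i))) (u ord_max)) ->
  forall k (u : 'I_k -> R), nrm (\sum_(i < k) of_real K (u i) *: a i) = N k u.
Proof.
move=> N0 NS; elim=> [|k IH] u; first by rewrite big_ord0 nrm0 N0.
by rewrite nrm_sum_recr NS IH.
Qed.

(** The functional equation is solved for nonnegative arguments only, while coefficients may have
    any sign. *)
Lemma pair_norm_abs s t : F s t = F `|s| `|t|.
Proof.
by have [s0|s0] := leP 0 s; have [t0|t0] := leP 0 t;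
  rewrite ?(ger0_norm s0) ?(ger0_norm t0) ?(ltr0_norm s0) ?(ltr0_norm t0)
    ?pair_normNl ?pair_normNr.
Qed.

End GenericWideSequence.

Theorem theorem3p3 (L : language) (R : realType) (K : scalar_kind)
    (kappa : Type) (C : banach_structure L R K) (M : set C) (p : pretype C)
    (a : nat -> C) :
  monster C kappa ->
  elementary_substructure M -> smaller kappa M ->
  is_type M p -> generically_stable M p -> wide M p ->
  generic_wide_sequence M p a ->
  (exists2 q : R, 1 <= q &
     forall (k : nat) (r : 'I_k -> R),
       nrm (\sum_(i < k) of_real K (r i) *: a i) =
         (\sum_(i < k) `|r i| `^ q) `^ q^-1)
  \/
  (forall (k : nat) (r : 'I_k -> R),
     nrm (\sum_(i < k) of_real K (r i) *: a i) =
       \big[Num.max/0]_(i < k) `|r i|).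
Proof.
move=> mC eM sM _ st _ ga.
pose F (s t : R) := nrm (of_real K s *: a 0%N + of_real K t *: a 1%N).
have Fs0 s : 0 <= s -> F s 0 = s by move=> s0; rewrite /F (pair_norm0r ga) ger0_norm.
have F0t t : 0 <= t -> F 0 t = t by move=> t0; rewrite /F (pair_norm0l ga) ger0_norm.
have Fr s t u : 0 <= s -> 0 <= t -> t <= u -> F s t <= F s u.
  by move=> *; apply: (pair_norm_le ga).
have Fl s t u : 0 <= t -> 0 <= s -> s <= u -> F s t <= F u t.
  by move=> *; apply: (pair_norm_le ga).
have FA' : forall r s t : R, 0 <= r -> 0 <= s -> 0 <= t ->
    F (F r s) t = F r (F s t) by move=> *; exact: (pair_normA mC eM sM st ga).
have [F1|F1] := eqVneq (F 1 1) 1; [right|left].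
  apply: (nrm_sum_fold ga) => [r|k r]; first by rewrite big_ord0.
  rewrite bigmax_ord_recr //; set m := \big[_/_]_(_ < k) _.
  have m0 : 0 <= m by exact: bigmax_ge_id.
  rewrite [RHS](pair_norm_abs ga) (ger0_norm m0).
  by rewrite -(binorm_max (pair_normZ (a := a)) Fs0 F0t Fr Fl F1).
have [q q1 Fq] := binorm_powR (pair_normZ (a := a)) Fs0 F0t Fr FA' (pair_norm11_le ga) F1.
have q0 : q != 0 by rewrite gt_eqF // (lt_le_trans ltr01).
exists q => //; apply: (nrm_sum_fold ga) => [r|k r].
  (* The empty sum: 0 to the power 0 is 1 for [powR], so [q^-1] must be nonzero. *)
  by rewrite big_ord0 powR0 ?invr_eq0.
rewrite big_ord_recr /=; set m := \sum_(i < k) _.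
have m0 : 0 <= m by rewrite sumr_ge0 // => i _; exact: powR_ge0.
rewrite [RHS](pair_norm_abs ga) (ger0_norm (powR_ge0 _ _)).
rewrite [RHS](Fq _ _ (powR_ge0 _ _) (normr_ge0 _)) -powRrM mulVf //.
by rewrite powRr1.
Qed.
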